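(* Let $\overline{E}$ be a nonempty finite family of nonempty convex polytopes in $\mathbb{R}^{n+1}$, and let $h\colon\mathbb{R}^n\to\mathbb{R}$ be the piecewise affine function $$h(x)=\min_{C\in\overline{E}}\ \max_{[a,v]\in C}\,[a+\langle v,x\rangle].$$ Then $h$ is bounded from below on $\mathbb{R}^n$ if and only if $$C\cap L_0\neq\emptyset\quad\text{for all } C\in\overline{E},$$ where $L_0=\{(a,0_n)\in\mathbb{R}^{n+1} : a\in\mathbb{R}\}$.
   Context: Points of $\mathbb{R}^{n+1}$ are written $[a,v]$ or $(a,v)$ with $a\in\mathbb{R}$, $v\in\mathbb{R}^n$; $0_n$ is the zero vector of $\mathbb{R}^n$ and $\langle\cdot,\cdot\rangle$ is the standard inner product. A convex polytope is the convex hull of a finite set of points. *)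

(* Defs.v *)
From mathcomp Require Import all_boot all_order all_algebra interval_inference.
From mathcomp Require Import all_classical all_reals all_analysis.

Set Implicit Arguments.
Unset Strict Implicit.
Unset Printing Implicit Defensive.

Import Order.TTheory GRing.Theory Num.Theory.

Local Open Scope classical_set_scope.
Local Open Scope ring_scope.

(* R^(n+1), with its points split as (a, v), a in R, v in R^n.  R^o is R seen
   as a module over itself, so that the product is an R-module. *)
Definition pt (R : realType) (n : nat) : lmodType R := (R^o * 'rV[R]_n)%type.

Definition dotp (R : realType) (n : nat) (v x : 'rV[R]_n) : R :=
  \sum_(i < n) v 0 i * x 0 i.

Definition convex_hull (R : realType) (M : lmodType R) (A : set M) : set M :=
  smallest (@convex_set R M) A.

Definition convex_polytope (R : realType) (M : lmodType R) (C : set M) : Prop :=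
  exists2 F : set M, finite_set F & C = convex_hull F.

(* Greatest and least *elements*; the value is a junk 0 when there is none,
   which polytope_maxP and minmaxP below show not to happen in minmax. *)
Definition setmax (R : realType) (A : set R) : R := xget 0 (A `&` ubound A).
Definition setmin (R : realType) (A : set R) : R := xget 0 (A `&` lbound A).

Definition affine_val (R : realType) (n : nat) (x : 'rV[R]_n) (p : pt R n) : R :=
  p.1 + dotp p.2 x.

Definition minmax (R : realType) (n : nat) (E : set (set (pt R n)))
    (x : 'rV[R]_n) : R :=
  setmin [set setmax [set affine_val x p | p in C] | C in E].

Definition L0 (R : realType) (n : nat) : set (pt R n) :=
  [set (a, 0) | a in [set: R]].

Lemma finite_image_max (R : realType) (T : Type) (F : set T) (f : T -> R) :
  finite_set F -> F !=set0 -> exists2 p, F p & forall q, F q -> f q <= f p.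
Proof.
move=> finF; elim/Pchoice: T => T in F f finF *.
have /finite_seqP[s ->] := finF => -[p0 p0s].
elim: s p0 p0s => // a [|b s] IH p0 _.
  by exists a => [|q] /=; rewrite mem_seq1 // => /eqP ->.
have [p ps pmax] := IH b (mem_head b s).
have [le_pa|lt_ap] := leP (f p) (f a).
- exists a; first exact: mem_head.
  move=> q /=; rewrite in_cons => /orP[/eqP -> //|qs].
  exact: le_trans (pmax _ qs) le_pa.
- exists p; first by rewrite /= in_cons [p \in _]ps orbT.
  by move=> q /=; rewrite in_cons => /orP[/eqP ->|/pmax //]; exact: ltW.
Qed.

Lemma convex_le (R : realType) (n : nat) (x : 'rV[R]_n) (m : R) :
  convex_set ([set p | affine_val x p <= m] : set (convex_lmodType (pt R n))).
Proof.
move=> p q l; rewrite !inE /= => pm qm.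
have -> : affine_val x (conv l p q : pt R n) =
    l%:num * affine_val x p + (1 - l%:num) * affine_val x q.
  rewrite /affine_val /dotp /= !mulrDr !mulr_sumr addrACA -big_split /=.
  congr (_ + _ + _); apply: eq_bigr => i _.
  by rewrite !mxE mulrDl !mulrA.
have -> : m = l%:num * m + (1 - l%:num) * m by rewrite -mulrDl subrKC mul1r.
by rewrite lerD// ler_wpM2l// subr_ge0.
Qed.

Lemma polytope_maxP (R : realType) (n : nat) (C : set (pt R n)) (x : 'rV[R]_n) :
  convex_polytope C -> C !=set0 ->
  let A := [set affine_val x p | p in C] in A (setmax A) /\ ubound A (setmax A).
Proof.
move=> [F finF ->] C0 A.
have F0 : F !=set0.
  apply/set0P/negP => /eqP FE; case: C0 => p /(_ set0) -[]//.
  by split=> [? ? ?|]; rewrite ?FE// inE.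
have [p Fp pmax] := finite_image_max (affine_val x) finF F0.
suff : (A `&` ubound A) (affine_val x p) by apply: xgetI.
split; first by exists p => //; exact: sub_gen_smallest.
move=> _ [q Cq <-].
by apply: (Cq [set q | affine_val x q <= affine_val x p]); split;
  [exact: convex_le | exact: pmax].
Qed.

Lemma minmaxP (R : realType) (n : nat) (E : set (set (pt R n))) (x : 'rV[R]_n) :
  finite_set E -> E !=set0 ->
  let A := [set setmax [set affine_val x p | p in C] | C in E] in
  A (minmax E x) /\ lbound A (minmax E x).
Proof.
move=> finE E0 A.
have [C EC Cmin] :=
  finite_image_max (fun C => - setmax [set affine_val x p | p in C]) finE E0.
suff : (A `&` lbound A) (setmax [set affine_val x p | p in C]) by apply: xgetI.
split; first by exists C.
by move=> _ [D ED <-]; rewrite -lerN2; exact: Cmin.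
Qed.

(* Main.v *)
Require Import Defs.
From mathcomp Require Import all_boot all_order all_algebra.
From mathcomp Require Import all_classical all_reals all_analysis.
From mathcomp Require Import interval_inference ring lra.

Import Order.TTheory GRing.Theory Num.Theory.

Local Open Scope classical_set_scope.
Local Open Scope ring_scope.

(** For the direction from the geometric condition to boundedness, a point
[(a, 0)] of [C] contributes the constant function [a] to the maximum over
[C], so that maximum is everywhere at least [a]; as there are finitely many
polytopes, the least of these constants bounds [h] from below.

Conversely, suppose that [C] does not meet the axis [L0].  The projection of
[C] to [R^n] is then a convex set that misses the origin, and the vertices of
[C] project to finitely many points of it.  Gordan's alternative
([gordan_alternative]) gives a direction [x] whose inner product with each of
these points is negative.  Along the ray [t x] all the affine functions given
by the vertices of [C] tend to minus infinity, uniformly as they are finitely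
many ([negative_slopes_escape]); a maximum over [C] is bounded by the maximum
over the vertices, so [h] tends to minus infinity along this ray. *)

Section InnerProduct.
Context {R : realType} {n : nat}.
Implicit Types u v x y : 'rV[R]_n.

Lemma dotpC u v : dotp u v = dotp v u.
Proof. by apply: eq_bigr => i _; rewrite mulrC. Qed.

Lemma dotpDr u x y : dotp u (x + y) = dotp u x + dotp u y.
Proof. by rewrite -big_split; apply: eq_bigr => i _; rewrite mxE mulrDr. Qed.

Lemma dotpZr u (a : R) x : dotp u (a *: x) = a * dotp u x.
Proof. by rewrite mulr_sumr; apply: eq_bigr => i _; rewrite mxE mulrCA. Qed.

Lemma dotpNr u x : dotp u (- x) = - dotp u x.
Proof. by rewrite -scaleN1r dotpZr mulN1r. Qed.

Lemma dotpDl u v x : dotp (u + v) x = dotp u x + dotp v x.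
Proof. by rewrite !(dotpC _ x) dotpDr. Qed.

Lemma dotpZl (a : R) u x : dotp (a *: u) x = a * dotp u x.
Proof. by rewrite !(dotpC _ x) dotpZr. Qed.

Lemma dotp0l x : dotp 0 x = 0.
Proof. by rewrite -(scale0r (0 : 'rV[R]_n)) dotpZl mul0r. Qed.

Lemma dotp_gt0 u : u != 0 -> 0 < dotp u u.
Proof.
move=> u0; have sq_ge0 (i : 'I_n) : true -> 0 <= u 0 i * u 0 i.
  by move=> _; rewrite -expr2 sqr_ge0.
rewrite lt_def sumr_ge0 // andbT; apply: contra u0.
rewrite psumr_eq0 // => /allP uu0; apply/eqP/rowP => i; rewrite mxE.
by have := uu0 i (mem_index_enum i); rewrite /= mulf_eq0 orbb => /eqP.
Qed.

End InnerProduct.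

Section Convexity.
Context {R : realType}.

Lemma convex_setP {M : lmodType R} {K : set M} {p q : M} {l : R} :
  convex_set (K : set (convex_lmodType M)) -> K p -> K q -> 0 <= l <= 1 ->
  K (l *: p + (1 - l) *: q).
Proof.
move=> cK Kp Kq l01.
have Il : Itv.spec (Itv.num_sem (R:=R)) (Itv.Real `[0%Z, 1%Z]) l.
  rewrite /= /Itv.num_sem /= in_itv /= l01 andbT.
  by case/andP: l01 => l0 _; rewrite realE l0.
have := cK p q (Itv.mk Il); rewrite !inE; exact.
Qed.

Lemma convex_convex_hull {M : lmodType R} (A : set M) :
  convex_set (convex_hull A : set (convex_lmodType M)).
Proof.
move=> p q l; rewrite !inE => Ap Aq D [cD AD].
by have := cD p q l; rewrite !inE; apply; [exact: Ap | exact: Aq].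
Qed.

End Convexity.

(** Finitely many affine functions of [t] with negative slopes are
simultaneously below any level for large [t].  Besides the descent along a
ray, this provides the small step of [gordan_alternative], as a multiple [t]
of a vector to be perturbed by a fixed one. *)
Lemma negative_slopes_escape {R : realType} {T : Type} {F : set T}
    (a d : T -> R) (m : R) :
  finite_set F -> (forall i, F i -> d i < 0) ->
  exists2 t, 0 < t & forall i, F i -> a i + t * d i < m.
Proof.
move=> finF d0; have [->|/set0P F0] := eqVneq F set0; first by exists 1.
have [i Fi amax] := finite_image_max a finF F0.
have [j Fj dmax] := finite_image_max d finF F0.
have dj0 := d0 _ Fj.
exists ((`|a i - m| + 1) / - d j).
  by rewrite divr_gt0 ?oppr_gt0 // ltr_wpDl.
move=> k Fk; have tge0 : 0 <= (`|a i - m| + 1) / - d j.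
  by rewrite divr_ge0 ?addr_ge0 // oppr_ge0 ltW.
apply: (@le_lt_trans _ _ (a i + (`|a i - m| + 1) / - d j * d j)).
  by rewrite lerD ?amax // ler_wpM2l // dmax.
rewrite invrN mulrN mulNr divfK ?lt_eqF //.
have := ler_norm (a i - m); lra.
Qed.

(** By induction on the number of vectors, some [x] is negative on all the
[v i], and a nonzero vector [w] is added.  It suffices to find a [z] negative
on all the [v i] and at most zero on [w]: a small step from [z] in the
direction [- w] makes it negative on [w] too.  If [x] is not such a [z], it is
positive on [w], so the segment from [w] to [v i] meets the hyperplane
orthogonal to [x] at a point [u i] that lies in [K] again, and the induction
hypothesis applies to these points.  If [y] is negative on all of them, then
the sum of [y] and a multiple of [x] that is orthogonal to [w] takes the same
value as [y] on each [u i], hence is negative on each [v i], and serves as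
[z]. *)
Lemma gordan_alternative {R : realType} {n : nat} {K : set 'rV[R]_n}
    {T : eqType} (s : seq T) (v : T -> 'rV[R]_n) :
  convex_set (K : set (convex_lmodType 'rV[R]_n)) ->
  (forall i, i \in s -> K (v i)) ->
  K 0 \/ exists x, forall i, i \in s -> dotp (v i) x < 0.
Proof.
move=> cK; elim: s v => [|j s IH] v Kv; first by right; exists 0.
have Ks i : i \in s -> K (v i) by move=> si; apply: Kv; rewrite inE si orbT.
set w := v j; have Kw : K w by apply: Kv; rewrite mem_head.
have [w0|w_neq0] := eqVneq w 0; first by left; rewrite -w0.
have [|[x xs]] := IH v Ks; first by left.
suff [K0|[z zw zs]] :
    K 0 \/ exists2 z, dotp w z <= 0 & forall i, i \in s -> dotp (v i) z < 0.
- by left.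
- right; have [t t0 tE] := @negative_slopes_escape R T [set` s]
    (fun i => - dotp (v i) w) (fun i => dotp (v i) z) 0 (finite_seq s) zs.
  exists (- w + t *: z) => i; rewrite inE dotpDr dotpNr dotpZr.
  case/orP => [/eqP->|/tE //]; rewrite -/w.
  have := dotp_gt0 w w_neq0; have := mulr_ge0_le0 (ltW t0) zw; lra.
have [xw|xw] := leP (dotp w x) 0; first by right; exists x.
(* The weight of [v i] for which the segment to [w] is orthogonal to [x]. *)
pose l i := dotp w x / (dotp w x - dotp (v i) x).
pose u i := l i *: v i + (1 - l i) *: w.
have den_gt0 i : i \in s -> 0 < dotp w x - dotp (v i) x.
  by move=> /xs; lra.
have Ku i : i \in s -> K (u i).
  move=> si; apply: (convex_setP cK) => //; first exact: Ks.
  apply/andP; split; first by rewrite divr_ge0 ?(ltW (den_gt0 _ si)) // ltW.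
  by rewrite ler_pdivrMr ?den_gt0 // mul1r; have := xs _ si; lra.
have [|[y ys]] := IH u Ku; first by left.
right; exists (y - (dotp w y / dotp w x) *: x) => [|i si].
  by rewrite dotpDr dotpNr dotpZr divfK ?gt_eqF // subrr.
have := ys _ si; rewrite dotpDl !dotpZl dotpDr dotpNr dotpZr.
have li0 : 0 < l i by rewrite divr_gt0 ?den_gt0.
suff -> : l i * dotp (v i) y + (1 - l i) * dotp w y =
    l i * (dotp (v i) y - dotp w y / dotp w x * dotp (v i) x).
  by rewrite pmulr_rlt0.
rewrite /l; field.
by rewrite !gt_eqF ?den_gt0.
Qed.

(** A convex hull meets [L0] exactly when its projection to [R^n] contains the
origin; this is the alternative for that projection and the projected
generators. *)
Lemma convex_hull_axis_alternative {R : realType} {n : nat} {F : set (pt R n)} :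
  finite_set F ->
  convex_hull F `&` @L0 R n !=set0 \/
  exists x, forall p, F p -> dotp p.2 x < 0.
Proof.
move=> /finite_seqP[s Fs].
pose K : set 'rV[R]_n := [set p.2 | p in convex_hull F].
have cK : convex_set (K : set (convex_lmodType 'rV[R]_n)).
  move=> p q l; rewrite !inE => -[p' Fp <-] [q' Fq <-].
  exists (conv l (p' : convex_lmodType (pt R n)) q') => //.
  have := convex_convex_hull F (p' : convex_lmodType (pt R n)) q' l.
  by rewrite !inE; exact.
have Ks p : p \in s -> K p.2.
  by move=> sp; exists p => //; apply: sub_gen_smallest; rewrite Fs.
have [[[a v] Fav /= v0]|[x xs]] := gordan_alternative s (fun p => p.2) cK Ks.
  by left; exists (a, v); split => //; exists a; rewrite // v0.
by right; exists x => p; rewrite Fs => /xs.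
Qed.

Theorem theorem2 (R : realType) (n : nat) (E : set (set (pt R n)))
    (finE : finite_set E) (E0 : E !=set0)
    (polyE : forall C, E C -> convex_polytope C /\ C !=set0) :
  has_lbound (range (minmax E)) <->
  (forall C, E C -> C `&` @L0 R n !=set0).
Proof.
split=> [[m mE] C EC|meet].
- have [polyC C0] := polyE C EC; have [F finF CF] := polyC.
  rewrite CF; have [//|[x xF]] := convex_hull_axis_alternative finF.
  (* The level [m - 1] turns the strict bounds at the vertices into a strict
     bound on all of [C], through a closed half-space. *)
  have [t _ tE] :=
    negative_slopes_escape (fun p : pt R n => p.1) _ (m - 1) finF xF.
  have [[p Cp pmax] _] := polytope_maxP (t *: x) polyC C0.
  have pm : affine_val (t *: x) p <= m - 1.
    move: Cp; rewrite CF => Cp.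
    apply: (Cp [set q | affine_val (t *: x) q <= m - 1]).
    split; first exact: convex_le.
    by move=> q /tE /ltW; rewrite /= /affine_val dotpZr.
  have [_ hmin] := minmaxP (t *: x) finE E0.
  have mh : m <= minmax E (t *: x) by apply: mE; exists (t *: x).
  have hp : minmax E (t *: x) <= affine_val (t *: x) p.
    by rewrite pmax; apply: hmin; exists C.
  by have := le_trans mh (le_trans hp pm); rewrite lerDl oppr_ge0 ler10.
- have pick C : exists a : R, E C -> C (a, 0).
    have [/meet[p [Cp [a _ ap]]]|nEC] := pselect (E C); last by exists 0.
    by exists a; rewrite ap.
  have [a aE] := choice pick.
  have [C EC Cmin] := finite_image_max (fun C => - a C) finE E0.
  exists (a C) => _ [x _ <-].
  have [[D ED <-] _] := minmaxP x finE E0.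
  have [polyD D0] := polyE D ED; have [_ Dmax] := polytope_maxP x polyD D0.
  apply: (@le_trans _ _ (a D)); first by rewrite -lerN2 Cmin.
  by apply: Dmax; exists (a D, 0); [exact: aE | rewrite /affine_val dotp0l addr0].
Qed.
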